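(* Let $\gamma>0$, $\varepsilon>0$, $p\in(0,1)$, let $1\leq L\leq\#(\mathscr{M})$ be an integer, and assume that $$D=\sup_{\mathbf{x},\mathbf{x}'\in\mathcal{X}}\Vert\mathbf{g}(\mathbf{x})-\mathbf{g}(\mathbf{x}')\Vert_2<\infty.$$ Let $\mathbf{x}_1,\mathbf{x}_1',\dots,\mathbf{x}_m,\mathbf{x}_m'$ be sampled independently according to the probability measure $\mu$ on $\mathcal{X}$, where $$m\geq\frac{D^4}{2\varepsilon^2}\left[L\ln\#(\mathscr{M})-\ln\left((L-1)!\right)-\ln\left(\frac p2\right)\right].$$ Let $1\leq K\leq L$ and let $\mathscr{S}^*$ maximize $f_\gamma(\mathscr{S})$ over all $\mathscr{S}\subseteq\mathscr{M}$ with $\#(\mathscr{S})\leq K$. If $\mathscr{S}_1,\dots,\mathscr{S}_L$ is the sequence of subsets selected by the greedy algorithm using the sampled objective $f_{\gamma,m}$, then with probability at least $1-p$ over the sample points, $$f_\gamma(\mathscr{S}_k)\geq\left(1-e^{-k/K}\right)f_\gamma(\mathscr{S}^* )-\left(2-e^{-k/K}\right)\varepsilon,\qquad k=1,\dots,L.$$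
   Context: $\mathcal{X}\subset\mathbb{R}^n$ carries a probability measure $\mu$; $\mathscr{M}$ is a finite set of sensors; the target $\mathbf{g}:\mathcal{X}\to\mathbb{R}^q$ and measurements $\mathbf{m}_j:\mathcal{X}\to\mathbb{R}^{d_j}$, $j\in\mathscr{M}$, are measurable. $\#(\cdot)$ denotes cardinality. For $\mathscr{S}\subseteq\mathscr{M}$, $\mathbf{m}_{\mathscr{S}}=(\mathbf{m}_j)_{j\in\mathscr{S}}$ is the concatenated measurement and $$w_{\gamma,\mathbf{x},\mathbf{x}'}(\mathscr{S})=\min\left\{\tfrac{1}{\gamma^2}\Vert\mathbf{m}_{\mathscr{S}}(\mathbf{x})-\mathbf{m}_{\mathscr{S}}(\mathbf{x}')\Vert_2^2,\ 1\right\},$$ $$f_\gamma(\mathscr{S})=\int_{\mathcal{X}\times\mathcal{X}}w_{\gamma,\mathbf{x},\mathbf{x}'}(\mathscr{S})\Vert\mathbf{g}(\mathbf{x})-\mathbf{g}(\mathbf{x}')\Vert_2^2\,d\mu(\mathbf{x})\,d\mu(\mathbf{x}'),$$ $$f_{\gamma,m}(\mathscr{S})=\frac1m\sum_{i=1}^m w_{\gamma,\mathbf{x}_i,\mathbf{x}_i'}(\mathscr{S})\Vert\mathbf{g}(\mathbf{x}_i)-\mathbf{g}(\mathbf{x}_i')\Vert_2^2.$$ The greedy algorithm for an objective $f$ starts with $\mathscr{S}_0=\emptyset$ and sets $\mathscr{S}_k=\mathscr{S}_{k-1}\cup\{j_k\}$, where $j_k$ maximizes $f(\mathscr{S}_{k-1}\cup\{j\})$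 over $j\in\mathscr{M}\setminus\mathscr{S}_{k-1}$. *)

(* Defs.v *)
From HB Require Import structures.
From mathcomp Require Import all_boot all_order all_algebra.
From mathcomp Require Import all_classical all_reals all_analysis.

Set Implicit Arguments.
Unset Strict Implicit.
Unset Printing Implicit Defensive.

Import Order.TTheory GRing.Theory Num.Theory.
Import numFieldNormedType.Exports.

Local Open Scope classical_set_scope.
Local Open Scope ring_scope.

(* R^n with its Borel sigma-algebra; MathComp-Analysis puts no measurable
   structure on 'rV[R]_n itself. *)
Definition borel_rV (R : realType) (n : nat) :=
  g_sigma_algebraType (@open 'rV[R]_n).

Definition borel_measurable (R : realType) (d : measure_display)
    (T : measurableType d) (n : nat) (f : T -> 'rV[R]_n) : Prop :=
  measurable_fun setT (f : T -> borel_rV R n).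

(* An arbitrary subset X of R^n as a type, with the trace of the Borel
   sigma-algebra.  Measurable types are pointed in MathComp-Analysis, hence the
   nonemptiness proof (automatic as soon as X carries a probability). *)
Definition domain (R : realType) (n : nat) (X : set 'rV[R]_n)
  (X0 : X !=set0) : Type := {x : 'rV[R]_n | x \in X}.

Section domain_structure.
Context (R : realType) (n : nat) (X : set 'rV[R]_n) (X0 : X !=set0).

Definition domain_point : domain X0 :=
  exist _ (projT1 (cid X0)) (mem_set (projT2 (cid X0))).

HB.instance Definition _ := Choice.on (domain X0).
HB.instance Definition _ := isPointed.Build (domain X0) domain_point.

Definition domain_val : domain X0 -> borel_rV R n := @sval _ _.

HB.instance Definition _ := Measurable.copy (domain X0)
  (g_sigma_algebra_preimageType domain_val).

End domain_structure.

(* The Euclidean norm; the canonical norm of 'rV[R]_n is the sup norm. *)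
Definition norm2 (R : realType) (n : nat) (v : 'rV[R]_n) : R :=
  Num.sqrt (\sum_i v 0 i ^+ 2).

Section sensors.
Context (R : realType) (M : finType) (T : Type) (q : nat) (dim : M -> nat).
Context (g : T -> 'rV[R]_q) (m_ : forall j, T -> 'rV[R]_(dim j)).

Definition concat_meas (S : {set M}) (x : T) :
    'rV[R]_(\sum_(i < #|S|) dim (enum_val i)) :=
  \mxrow_(i < #|S|) m_ (enum_val i) x.

Definition weight (gamma : R) (x x' : T) (S : {set M}) : R :=
  Num.min (1 / gamma ^+ 2 * norm2 (concat_meas S x - concat_meas S x') ^+ 2) 1.

Definition integrand (gamma : R) (x x' : T) (S : {set M}) : R :=
  weight gamma x x' S * norm2 (g x - g x') ^+ 2.

Definition sampled_objective (m : nat) (gamma : R) (x x' : 'I_m -> T)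
    (S : {set M}) : R :=
  1 / m%:R * \sum_(i < m) integrand gamma (x i) (x' i) S.

End sensors.

Definition objective (R : realType) (M : finType) (d : measure_display)
    (T : measurableType d) (mu : probability T R) (q : nat) (dim : M -> nat)
    (g : T -> 'rV[R]_q) (m_ : forall j, T -> 'rV[R]_(dim j))
    (gamma : R) (S : {set M}) : R :=
  \int[(mu \x mu)%E]_z integrand g m_ gamma z.1 z.2 S.

(* S 0, ..., S L is a possible run of the greedy algorithm: ties between
   maximizers may be broken in any way. *)
Definition greedy_run (R : realType) (M : finType) (f : {set M} -> R)
    (L : nat) (S : nat -> {set M}) : Prop :=
  S 0%N = finset.set0 /\
  forall k, (k < L)%N -> exists2 j, j \notin S k &
    S k.+1 = (S k :|: [set j])%SET /\
    forall j', j' \notin S k -> f (S k :|: [set j'])%SET <= f (S k :|: [set j])%SET.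

Definition mutually_independent (R : realType) (d d' : measure_display)
    (Omega : measurableType d) (T : measurableType d')
    (P : probability Omega R) (I : finType) (Y : I -> Omega -> T) : Prop :=
  forall (J : {set I}) (A : I -> set T),
    (forall i, i \in J -> measurable (A i)) ->
    P (\bigcap_(i in [set` J]) (Y i @^-1` A i)) =
      (\prod_(i in J) P (Y i @^-1` A i))%E.

Definition iid_sample (R : realType) (d d' : measure_display)
    (Omega : measurableType d) (T : measurableType d')
    (P : probability Omega R) (mu : probability T R)
    (I : finType) (Y : I -> Omega -> T) : Prop :=
  [/\ forall i, measurable_fun setT (Y i),
      forall i A, measurable A -> P (Y i @^-1` A) = mu A &
      mutually_independent P Y].

(* The 2m points x_1, x'_1, ..., x_m, x'_m as a single family, so that
   independence is that of all of them jointly. *)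
Definition pooled (A B : Type) (x x' : A -> B) (s : A + A) : B :=
  match s with inl i => x i | inr i => x' i end.

(* Main.v *)
Require Import Defs.
From HB Require Import structures.
From mathcomp Require Import all_boot all_order all_algebra.
From mathcomp Require Import all_classical all_reals all_analysis.
From mathcomp Require Import measurable_realfun ring lra.

(** The sampled objective is a nonnegative combination of truncated sums
min(sum_{j in S} a_j, 1), because the squared Euclidean norm of a concatenated
measurement is the sum of the squared norms of its blocks.  Truncated sums are
monotone, vanish on the empty set, and satisfy the diminishing-returns bound
f(T) <= f(S) + sum_{j in T \ S} (f(S + j) - f(S)); all three properties survive
nonnegative combinations.  The classical argument for greedy maximization then
applies to every realization of the sampled objective: the best single sensor
closes at least a fraction 1/K of the gap to any competitor of size at most K,
hence the factor (1 - 1/K)^k <= exp(-k/K) (greedy_run_approx).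

So a realization is good as soon as the sampled and the true objective differ by
at most eps on every set of at most L sensors: eps is lost once when the
sampled objective is compared with the true one at the competitor, with factor
1 - exp(-k/K), and once more at the greedy set, which adds up to
2 - exp(-k/K) (greedy_run_sampled_approx).

For one fixed set, Hoeffding's inequality for m independent variables with
values in [0, D^2] bounds the probability of a deviation of eps or more, on
either side, by exp(-2 m eps^2 / D^4).  On the empty set both objectives
vanish, and there are at most n^L / (L-1)! nonempty sets of at most L sensors
among n, since C(n, k) <= n^k / k! <= n^L / L! for 1 <= k <= L <= n and there
are L values of k (card_small_sets).  The assumed sample size makes the union
bound over these sets and both sides at most p (sample_size_bound,
uniform_deviation).  If D = 0 every integrand is zero and there is nothing to
estimate.

Hoeffding's inequality follows from exponential moments.  The bound
1 - t + t e^u <= exp(t u + u^2 / 8) controls the moment generating function of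
one bounded variable, and the expectation of the product over the m pairs of
sample points factorizes (expectation_prod_iid_pairs).  Independence being given
as a product rule for events, the factorization is obtained by absorbing the
sample points one at a time into a running product while keeping it independent
of the points still to come, with uniqueness of product measures at each step.

Finally the event of the theorem depends on the sample only through the finitely
many comparisons between values of the sampled objective, so it is measurable
(measurable_comparison_event).  *)

Set Implicit Arguments.
Unset Strict Implicit.
Unset Printing Implicit Defensive.

Import Order.TTheory GRing.Theory Num.Theory.
Import numFieldNormedType.Exports.

Local Open Scope classical_set_scope.
Local Open Scope ring_scope.

(** * Greedy maximization under diminishing returns *)

Lemma norm2_sqr (R : realType) (n : nat) (v : 'rV[R]_n) :
  norm2 v ^+ 2 = \sum_i v 0 i ^+ 2.
Proof. by rewrite sqr_sqrtr// sumr_ge0// => i _; exact: sqr_ge0. Qed.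

Lemma norm2_sqr_mulmx (R : realType) (n : nat) (v : 'rV[R]_n) :
  norm2 v ^+ 2 = (v *m v^T) 0 0.
Proof. by rewrite norm2_sqr mxE; apply: eq_bigr => i _; rewrite mxE expr2. Qed.

(** Concatenation makes the squared distance additive over sensors, which is what
turns the weight into a truncated sum. *)
Lemma norm2_sqr_concat (R : realType) (M : finType) (T : Type) (dim : M -> nat)
    (m_ : forall j, T -> 'rV[R]_(dim j)) (S : {set M}) (x x' : T) :
  norm2 (concat_meas m_ S x - concat_meas m_ S x') ^+ 2 =
  \sum_(j in S) norm2 (m_ j x - m_ j x') ^+ 2.
Proof.
rewrite norm2_sqr_mulmx /concat_meas -mxrowB tr_mxrow mul_mxrow_mxcol.
rewrite summxE [RHS]big_enum_val.
by apply: eq_bigr => i _; rewrite norm2_sqr_mulmx.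
Qed.

Section greedy.
Context (R : realType) (M : finType).
Implicit Types (f : {set M} -> R) (S T : {set M}).

Definition monotone_set f := forall S T, S \subset T -> f S <= f T.

(** The form of submodularity that the greedy argument uses: adding T to S all at
once gains no more than adding its elements to S separately. *)
Definition gain_bounded f := forall S T,
  f T <= f S + \sum_(j in T :\: S) (f (S :|: [set j])%SET - f S).

Lemma truncated_sum_monotone (a : M -> R) : (forall j, 0 <= a j) ->
  monotone_set (fun S => Num.min (\sum_(j in S) a j) 1).
Proof.
move=> a0 S T ST.
have H : \sum_(j in S) a j <= \sum_(j in T) a j.
  rewrite [leRHS](big_setID S)/= (finset.setIidPr ST) lerDl.
  by apply: sumr_ge0 => j _; exact: a0.
by rewrite le_min !ge_min lexx H orbT.
Qed.

(** If the sum over S, or the sum over S and one more element of T, reaches 1, the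
right-hand side already reaches the maximal value 1; otherwise no truncation
occurs on the right and the gains add up to the sum over T \ S. *)
Lemma truncated_sum_gain_bounded (a : M -> R) : (forall j, 0 <= a j) ->
  gain_bounded (fun S => Num.min (\sum_(j in S) a j) 1).
Proof.
move=> a0 S T; pose c (U : {set M}) := Num.min (\sum_(j in U) a j) 1.
rewrite -[leLHS]/(c T) -[leRHS]/(c S + \sum_(j in T :\: S) (c (S :|: [set j])%SET - c S)).
have mono := truncated_sum_monotone a0.
have gain0 j : 0 <= c (S :|: [set j])%SET - c S.
  by rewrite subr_ge0; apply: mono; exact: finset.subsetUl.
have c1 U : c U <= 1 by rewrite /c ge_min lexx orbT.
have sumU j : j \notin S -> \sum_(i in (S :|: [set j])%SET) a i =
    \sum_(i in S) a i + a j.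
  by move=> jS; rewrite finset.setUC big_setU1//= addrC.
have [S1|S1] := leP 1 (\sum_(j in S) a j).
  rewrite [X in _ <= X + _](_ : c S = 1); last by apply/eqP; rewrite eq_le c1 /c le_min S1 lexx.
  apply: le_trans (c1 T) _; rewrite lerDl; apply: sumr_ge0 => j _; exact: gain0.
have cS : c S = \sum_(j in S) a j by rewrite /c; apply/min_idPl/ltW.
have [/existsP[j /andP[jTS S1j]]|] :=
    boolP [exists j, (j \in T :\: S) && (1 <= \sum_(i in S) a i + a j)].
  rewrite (bigD1 j)//= addrA subrKC.
  apply: le_trans (c1 T) _.
  rewrite [c (_ :|: _)](_ : _ = 1).
    by rewrite lerDl; apply: sumr_ge0 => k _; exact: gain0.
  move: jTS; rewrite finset.in_setD => /andP[jS _].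
  by rewrite /c sumU//; apply/min_idPr.
rewrite negb_exists => /forallP small.
rewrite (eq_bigr a); last first.
  move=> j jTS; have := small j; rewrite jTS/= -ltNge => /ltW Sj1.
  move: jTS; rewrite finset.in_setD => /andP[jS _].
  by rewrite cS /c sumU// (min_idPl Sj1) addrC addKr.
rewrite cS {1}/c ge_min; apply/orP; left.
rewrite (big_setID S)/= lerD2r [leRHS](big_setID T)/= finset.setIC lerDl.
by apply: sumr_ge0 => j _; exact: a0.
Qed.

Lemma greedy_run_card f L (S : nat -> {set M}) : greedy_run f L S ->
  forall k, (k <= L)%N -> #|S k| = k.
Proof.
move=> [S0 step]; elim=> [|k IH] kL; first by rewrite S0 cards0.
have [j jS [-> _]] := step k kL.
by rewrite finset.setUC cardsU1 jS IH// ltnW.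
Qed.

(** The gap to a competitor T of size at most K is at most K times the next greedy
increment, so every step multiplies it by at most 1 - 1/K <= exp(-1/K). *)
Lemma greedy_run_approx f L (S : nat -> {set M}) T K : f finset.set0 = 0 ->
  monotone_set f -> gain_bounded f -> greedy_run f L S ->
  (0 < K)%N -> (#|T| <= K)%N ->
  forall k, (k <= L)%N -> (1 - expR (- (k%:R / K%:R))) * f T <= f (S k).
Proof.
move=> f0 mono gain [S0 step] K0 TK.
have fT0 : 0 <= f T by rewrite -f0; apply: mono; exact: finset.sub0set.
suff H k : (k <= L)%N -> f T - f (S k) <= expR (- (k%:R / K%:R)) * f T.
  by move=> k kL; rewrite mulrBl mul1r lerBlDr -lerBlDl; exact: H.
have K0R : 0 < K%:R :> R by rewrite ltr0n.
elim: k => [_|k IH kL]; first by rewrite S0 f0 subr0 mul0r oppr0 expR0 mul1r.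
have [j jS [Sk best]] := step k kL.
(* Each of the at most K gains in the diminishing-returns bound is at most the
   greedy one. *)
have gap : f T - f (S k) <= K%:R * (f (S k.+1) - f (S k)).
  rewrite lerBlDl; apply: le_trans (gain (S k) T) _; rewrite lerD2l.
  apply: (@le_trans _ _ (\sum_(j in T :\: S k) (f (S k.+1) - f (S k)))).
    apply: ler_sum => i; rewrite finset.in_setD => /andP[iS _].
    by rewrite lerD2r Sk; exact: best.
  rewrite sumr_const -[leLHS]mulr_natl ler_wpM2r//.
    by rewrite subr_ge0 Sk; apply: mono; exact: finset.subsetUl.
  by rewrite ler_nat (leq_trans _ TK)// subset_leq_card// finset.subsetDl.
have -> : f T - f (S k.+1) = (f T - f (S k)) - (f (S k.+1) - f (S k)).
  by rewrite opprB addrA subrK.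
apply: (@le_trans _ _ ((1 - K%:R^-1) * (f T - f (S k)))).
  rewrite mulrBl mul1r lerD2l lerN2 mulrC ler_pdivrMr// mulrC.
  exact: gap.
have K1 : 0 <= 1 - K%:R^-1 :> R by rewrite subr_ge0 invf_le1// ler1n.
apply: (le_trans (ler_wpM2l K1 (IH (ltnW kL)))).
rewrite mulrA ler_wpM2r//.
have -> : expR (- (k.+1%:R / K%:R)) = expR (- K%:R^-1) * expR (- (k%:R / K%:R)) :> R.
  by rewrite -expRD -natr1 mulrDl mul1r opprD addrC.
by rewrite ler_wpM2r ?expR_ge0//; exact: expR_ge1Dx.
Qed.

End greedy.

(** * Counting small subsets *)

(** The sequence n^k / k! is nondecreasing up to k = n; stated without division. *)
Lemma expn_fact_mono (n k : nat) : (k < n)%N ->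
  (n ^ k * k.+1`! <= n ^ k.+1 * k`!)%N.
Proof. by move=> kn; rewrite factS expnS mulnA leq_mul// mulnC leq_mul. Qed.

Lemma bin_le_expn_fact (n k : nat) : ('C(n, k) * k`! <= n ^ k)%N.
Proof.
rewrite bin_ffact; elim: k => // k IH.
by rewrite ffactnSr expnSr leq_mul// leq_subr.
Qed.

Lemma expn_fact_le (n k l : nat) : (k <= l)%N -> (l <= n)%N ->
  (n ^ k * l`! <= n ^ l * k`!)%N.
Proof.
elim: l => [|l IH]; first by rewrite leqn0 => /eqP->.
rewrite leq_eqVlt => /predU1P[->//|kl] ln.
have := leq_mul (IH kl (ltnW ln)) (expn_fact_mono ln).
rewrite -[X in (_ <= X -> _)%N]mulnA.
rewrite (_ : n ^ k * l`! * (n ^ l * l.+1`!) = (n ^ l * l`!) * (n ^ k * l.+1`!))%N; last by ring.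
rewrite (_ : n ^ l * (k`! * (n ^ l.+1 * l`!)) = (n ^ l * l`!) * (n ^ l.+1 * k`!))%N; last by ring.
rewrite leq_pmul2l// muln_gt0 fact_gt0 expn_gt0.
by rewrite (leq_ltn_trans (leq0n _) ln).
Qed.

(** Summing the bound C(n, k) <= n^k / k! <= n^L / L! over the L possible sizes
gives L n^L / L!, that is n^L / (L-1)!. *)
Lemma card_small_sets (M : finType) (L : nat) : (0 < L)%N -> (L <= #|M|)%N ->
  (#|[set S : {set M} | (0 < #|S| <= L)%N]%SET| * (L - 1)`! <= #|M| ^ L)%N.
Proof.
case: L => // L _ LM; rewrite subn1/=.
set A := [set S | _]%SET.
have -> : #|A| = (\sum_(k < L.+1) 'C(#|M|, k.+1))%N.
  transitivity (\sum_(k < L.+1) \sum_(S in A | #|S| == k.+1) 1)%N; last first.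
    apply: eq_bigr => k _; rewrite -card_draws sum1_card.
    apply: eq_card => S; rewrite unfold_in /= /A !finset.in_set.
    by case: eqP => [->|]; rewrite ?andbF ?andbT// ltn_ord.
  rewrite -sum1_card (partition_big (fun S : {set M} => inord #|S|.-1 : 'I_L.+1) xpredT)//=.
  apply: eq_bigr => k _; apply: eq_bigl => S; rewrite /A finset.in_set.
  case: #|S| => [|s]//=; rewrite ltnS eqSS; case: leqP => //= sL.
  by rewrite -(inj_eq val_inj)/= inordK.
have H (k : 'I_L.+1) : ('C(#|M|, k.+1) * L.+1`! <= #|M| ^ L.+1)%N.
  rewrite -(leq_pmul2r (fact_gt0 k.+1)) mulnAC.
  apply: leq_trans (expn_fact_le (ltn_ord k) LM).
  by rewrite leq_mul2r bin_le_expn_fact orbT.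
rewrite -(leq_pmul2l (ltn0Sn L)) mulnCA -factS big_distrl/=.
apply: (@leq_trans (\sum_(k < L.+1) #|M| ^ L.+1)).
  by apply: leq_sum => k _; exact: H.
by rewrite sum_nat_const card_ord.
Qed.

(** * Exponential moments of bounded variables *)

(** Mean value theorem; applied twice below, to a function and its derivative. *)
Lemma derive_ge0_nonneg (R : realType) (f f' : R -> R) :
  (forall x : R, is_derive x (1 : R) f (f' x)) -> f 0 = 0 ->
  (forall x, 0 <= x -> 0 <= f' x) -> forall u, 0 <= u -> 0 <= f u.
Proof.
move=> df f0 f'0 u u0.
have [|c /[!in_itv]/= /andP[c0 _]] := MVT_segment u0 (fun x _ => df x).
  apply: continuous_subspaceT => x.
  by apply/differentiable_continuous/derivable1_diffP; have [] := df x.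
by rewrite f0 !subr0 => ->; rewrite mulr_ge0// f'0.
Qed.

Section hoeffding_lemma.
Context (R : realType) (t : R).
Hypotheses (t0 : 0 <= t) (t1 : t <= 1).

(** psi is the difference of the logarithms of the two sides, G its derivative,
and v the tilted mean t e^u / N, written so that its derivative is easy:
v' = v (1 - v) <= 1/4. *)
Let N (u : R) : R := 1 - t + t * expR u.
Let v (u : R) : R := 1 - (1 - t) * (N u)^-1.
Let G (u : R) : R := 4^-1 * u + t - v u.
Let psi (u : R) : R := 8^-1 * u ^+ 2 + t * u - ln (N u).

Let N_gt0 u : 0 < N u.
Proof.
have e0 := expR_gt0 u; rewrite /N.
have [->|/negP t_neq0] := eqVneq t 0; first by rewrite subr0 mul0r addr0.
rewrite ltr_wpDl ?subr_ge0// mulr_gt0// lt_neqAle t0 andbT eq_sym; exact/negP.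
Qed.

Let dN (u : R) : is_derive u (1 : R) N (t * expR u).
Proof.
have -> : N = cst (1 - t) + t \*: (expR : R -> R^o) by apply/funext.
by apply: is_derive_eq; rewrite add0r.
Qed.

Let dpsi (u : R) : is_derive u (1 : R) psi (G u).
Proof.
have Nu := N_gt0 u.
have dln : is_derive u (1 : R) (@ln R \o N) ((N u)^-1 * (t * expR u)).
  by apply: is_derive1_comp; [exact: is_derive1_ln|exact: dN].
rewrite (_ : psi = 8^-1 \*: ((id : R -> R^o) ^+ 2) + t \*: (id : R -> R^o) -
    (@ln R \o N)); last by apply/funext.
apply: is_derive_eq; rewrite /G /v /GRing.scale/= expr1 !mulr1.
have Nu0 : N u != 0 by rewrite gt_eqF.
have -> : t * expR u = N u - (1 - t) by rewrite /N addrAC subrr add0r.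
by field.
Qed.

Let dG (u : R) : is_derive u (1 : R) G (4^-1 - v u * (1 - v u)).
Proof.
have Nu0 : N u != 0 by rewrite gt_eqF.
have dV := is_deriveV Nu0 (dN u).
rewrite (_ : G = 4^-1 \*: (id : R -> R^o) + cst t -
    (cst 1 - (1 - t) \*: ((fun x => (N x)^-1) : R -> R^o))); last by apply/funext.
apply: is_derive_eq; rewrite /v /GRing.scale/= !mulr1.
have -> : t * expR u = N u - (1 - t) by rewrite /N addrAC subrr add0r.
by field.
Qed.

(** The analytic core of Hoeffding's lemma: psi and its derivative vanish at 0, and
its second derivative 1/4 - v (1 - v) = (v - 1/2)^2 is nonnegative. *)
Lemma expR_chord_le u : 0 <= u ->
  1 - t + t * expR u <= expR (t * u + u ^+ 2 / 8).
Proof.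
move=> u0.
have N0 : N 0 = 1 by rewrite /N expR0 mulr1 subrK.
have G_ge0 x : 0 <= x -> 0 <= G x.
  apply: (derive_ge0_nonneg dG); first by rewrite /G /v N0 invr1; ring.
  move=> y _; have := sqr_ge0 (v y - 2^-1); lra.
have : 0 <= psi u.
  apply: (derive_ge0_nonneg dpsi) => //.
  by rewrite /psi N0 ln1; ring.
rewrite /psi subr_ge0 -ler_expR lnK ?posrE ?N_gt0//.
by move=> /le_trans; apply; rewrite ler_expR; lra.
Qed.

End hoeffding_lemma.

Section bounded_integral.
Context (R : realType) (d : measure_display) (U : measurableType d)
  (nu : probability U R).

Lemma bounded_integrable (h : U -> R) (b : R) : measurable_fun setT h ->
  (forall z, `|h z| <= b) -> nu.-integrable setT (EFin \o h).
Proof.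
move=> mh hb; apply: measurable_bounded_integrable => //.
  by rewrite (le_lt_trans (probability_le1 nu measurableT))// ltry.
exists b; split; first exact: num_real.
by move=> B bB z _; apply: le_trans (hb z) _; exact: ltW.
Qed.

Lemma expR_chord (y u : R) : 0 <= y <= 1 ->
  expR (u * y) <= 1 - y + y * expR u.
Proof.
move=> /andP[y0 y1].
have := convex_expR (Itv01 y0 y1) u 0.
by rewrite !convRE/= expR0 mulr0 addr0 mulr1 mulrC addrC.
Qed.

(** Hoeffding's lemma.  Replacing the exponential by its chord over [0, s b] leaves
an affine function of h, whose integral depends only on the mean of h. *)
Lemma mgf_bounded_le (h : U -> R) (b s : R) : measurable_fun setT h ->
  (forall z, 0 <= h z <= b) -> 0 < b -> 0 <= s ->
  \int[nu]_z expR (s * h z) <= expR (s * \int[nu]_z h z + (s * b) ^+ 2 / 8).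
Proof.
move=> mh hb b0 s0; set u := s * b; set mean := \int[nu]_z h z.
have h_int : nu.-integrable setT (EFin \o h).
  apply: (@bounded_integrable _ b) => // z.
  by have /andP[h0 ?] := hb z; rewrite ger0_norm.
have one_int : nu.-integrable setT (EFin \o cst (1 : R)).
  apply: (@bounded_integrable _ 1) => // z.
  by rewrite normr1.
have chord_int : nu.-integrable setT
    (EFin \o (fun z => 1 + (expR u - 1) / b * h z)).
  exact: (integrableD measurableT one_int
    (integrableZl measurableT ((expR u - 1) / b) h_int)).
apply: (@le_trans _ _ (\int[nu]_z (1 + (expR u - 1) / b * h z))).
  apply: le_Rintegral => //.
    apply: (@bounded_integrable _ (expR u)).
      by apply: measurableT_comp => //; exact: measurable_funM.
    move=> z; have /andP[h0 hb'] := hb z; rewrite ger0_norm ?expR_ge0//.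
    by rewrite ler_expR ler_wpM2l.
  move=> z _; have /andP[h0 hb'] := hb z.
  have /(expR_chord u) : 0 <= h z / b <= 1.
    by rewrite ler_pdivrMr// mul1r hb' divr_ge0// ltW.
  rewrite (_ : u * (h z / b) = s * h z); last by rewrite /u; field; rewrite gt_eqF.
  by move=> /le_trans; apply; rewrite le_eqVlt; apply/orP; left; apply/eqP; field; rewrite gt_eqF.
rewrite RintegralD//; last exact: (integrableZl measurableT _ h_int).
rewrite Rintegral_cst//= probability_setT mulr1 RintegralZl// -/mean.
have mean0 : 0 <= mean.
  by apply: Rintegral_ge0 => z _; have /andP[] := hb z.
have meanb : mean <= b.
  rewrite -[leRHS]mulr1 -(_ : fine (nu setT) = 1); last by rewrite probability_setT.
  rewrite -Rintegral_cst//; apply: le_Rintegral => //.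
    by apply: (@bounded_integrable _ b) => // z; rewrite ger0_norm// ltW.
  by move=> z _; have /andP[] := hb z.
have t0 : 0 <= mean / b by rewrite divr_ge0// ltW.
have t1 : mean / b <= 1 by rewrite ler_pdivrMr// mul1r.
have u0 : 0 <= u by rewrite mulr_ge0// ltW.
have := expR_chord_le t0 t1 u0.
rewrite (_ : mean / b * u = s * mean); last by rewrite /u; field; rewrite gt_eqF.
apply: le_trans; rewrite le_eqVlt; apply/orP; left; apply/eqP; field.
by rewrite gt_eqF.
Qed.

End bounded_integral.

(** * Independence of the sample pairs *)

Section independence.
Context (R : realType) (d d' : measure_display) (Omega : measurableType d)
  (T : measurableType d') (P : probability Omega R) (mu : probability T R)
  (I : finType) (Y : I -> Omega -> T).
Local Open Scope ereal_scope.

(** The set J holds the sample points not yet absorbed into V.  Only rectangles in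
these points are tested, so absorbing one more point amounts to identifying a
product measure from its values on rectangles. *)
Definition indep_remaining (dV : measure_display) (TV : measurableType dV)
    (V : Omega -> TV) (law : probability TV R) (J : {set I}) :=
  forall (B : set TV) (A : I -> set T), measurable B ->
    (forall i, measurable (A i)) ->
    P (V @^-1` B `&` \bigcap_(i in [set` J]) (Y i @^-1` A i)) =
    law B * \prod_(i in J) mu (A i).

Hypothesis mY : forall i, measurable_fun setT (Y i).

(** An unused point can be adjoined to V.  For fixed events on the other points, both
sides are finite measures in B that agree on rectangles, hence everywhere by
uniqueness of the product measure. *)
Lemma indep_remaining_pair (dV : measure_display) (TV : measurableType dV)
    (V : Omega -> TV) (law : probability TV R) (J : {set I}) (i : I) :
  measurable_fun setT V -> i \in J -> indep_remaining V law J ->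
  indep_remaining (fun w => (Y i w, V w)) (mu \x law : probability _ _)
    (J :\ i)%SET.
Proof.
move=> mV iJ indep B A mB mA.
have mF : measurable (\bigcap_(j in [set` (J :\ i)%SET]) (Y j @^-1` A j)).
  apply: fin_bigcap_measurable; first exact: finite_finset.
  by move=> j _; rewrite -[X in measurable X]setTI; exact: mY.
have mYV : measurable_fun setT (fun w => (Y i w, V w)).
  exact/measurable_fun_pair.
set r := \prod_(j in _) _.
have r0 : 0 <= r by apply: prode_ge0 => j _; exact: measure_ge0.
have rfin : r \is a fin_num.
  by apply: prode_fin_num => j _; exact: fin_num_measure.
(* The probability of the events on the other points enters as a constant factor
   of the first marginal. *)
pose s := NngNum (fine_ge0 r0).
have sE : s%:num%:E = r by rewrite /= fineK.
pose m' : {measure set (T * TV) -> \bar R} :=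
  pushforward (mrestr P mF) (fun w => (Y i w, V w)).
have H : forall A0 B0, measurable A0 -> measurable B0 ->
    m' mYV (A0 `*` B0) = mscale s mu A0 * law B0.
  move=> A0 B0 mA0 mB0.
  pose A' j := if j == i then A0 else A j.
  have A'i : A' i = A0 by rewrite /A' eqxx.
  have mA' j : measurable (A' j) by rewrite /A'; case: eqP.
  rewrite /m' /= /pushforward /mrestr /= /mscale/= sE.
  have := indep B0 A' mB0 mA'.
  rewrite (big_setD1 i)//= A'i (eq_bigr (fun j => mu (A j))); last first.
    by move=> j; rewrite finset.in_setD1 /A' => /andP[/negbTE ->].
  rewrite -/r (muleC r) [in X in _ -> X]muleC => <-.
  congr (P _); apply/seteqP; split => w /=.
    move=> [[Yw Vw] FW]; split=> // j /= jJ; rewrite /A'.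
    by case: eqP => [->//|/eqP ji]; apply: FW; rewrite /= finset.in_setD1 ji.
  move=> [Vw FW]; split; first split=> //.
    by have := FW i iJ; rewrite A'i.
  move=> j; rewrite /= finset.in_setD1 => /andP[ji jJ].
  by have := FW j jJ; rewrite /A' (negbTE ji).
have /(_ B mB) := product_measure_unique H.
rewrite /m' /= /pushforward /mrestr /= => <-.
rewrite /product_measure1 ge0_integral_mscale//=; first by rewrite fineK// muleC.
exact: measurable_fun_xsection.
Qed.

Lemma indep_remaining_map (dV dW : measure_display) (TV : measurableType dV)
    (TW : measurableType dW) (V : Omega -> TV) (law : probability TV R)
    (f : {mfun TV >-> TW}) (J : {set I}) :
  indep_remaining V law J ->
  indep_remaining (f \o V) (distribution law f : probability _ _) J.
Proof.
move=> indep B A mB mA; rewrite comp_preimage indep//.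
by rewrite -[X in measurable X]setTI; exact: measurable_funPT.
Qed.

(** With trivial events on the unused points, the independence rule reads that V has
the announced law. *)
Lemma indep_remaining_law (dV : measure_display) (TV : measurableType dV)
    (V : Omega -> TV) (law : probability TV R) (J : {set I})
    (f : TV -> \bar R) :
  measurable_fun setT V -> indep_remaining V law J ->
  measurable_fun setT f -> (forall v, 0 <= f v) ->
  \int[P]_w f (V w) = \int[law]_v f v.
Proof.
move=> mV indep mf f0.
have E B : measurable B -> P (V @^-1` B) = law B.
  move=> mB; have := indep B (fun=> setT) mB (fun=> measurableT).
  rewrite big1 ?mule1; last by move=> i _; exact: probability_setT.
  by move=> <-; congr (P _); apply/seteqP; split => [w Vw|w []//]; split.
transitivity (\int[pushforward P V]_v f v).
  by rewrite ge0_integral_pushforward//= => v _; exact: f0.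
by apply: eq_measure_integral => //= B mB _; exact: E.
Qed.

End independence.

Section iid_pairs.
Context (R : realType) (d d' : measure_display) (Omega : measurableType d)
  (T : measurableType d') (P : probability Omega R) (mu : probability T R)
  (m : nat) (x x' : 'I_m -> Omega -> T).
Hypothesis sample : iid_sample P mu (pooled x x').
Variables (phi : T * T -> R) (c : R).
Hypothesis mphi : measurable_fun setT phi.
Hypothesis phi0 : forall z, 0 <= phi z.
Hypothesis phic : (\int[mu \x mu]_z (phi z)%:E)%E = c%:E.

Let mY s : measurable_fun setT (pooled x x' s).
Proof. by have [] := sample. Qed.

Let W k w : R := \prod_(i < m | (i < k)%N) phi (x i w, x' i w).

Let pair_index (s : 'I_m + 'I_m) : nat :=
  match s with inl i => i | inr i => i end.

Let remaining k : {set 'I_m + 'I_m} := [set s | (k <= pair_index s)%N]%SET.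

Let mx i : measurable_fun setT (x i). Proof. exact: (mY (inl i)). Qed.
Let mx' i : measurable_fun setT (x' i). Proof. exact: (mY (inr i)). Qed.

Lemma measurable_pair_sample i :
  measurable_fun setT (fun w => phi (x i w, x' i w)).
Proof.
apply: (@measurableT_comp _ _ _ _ _ _ phi) => //.
exact: measurable_fun_pair.
Qed.

Let mW k : measurable_fun setT (W k).
Proof.
rewrite (_ : W k = fun w =>
    \prod_(i <- [seq i : 'I_m <- index_enum _ | (i < k)%N]) phi (x i w, x' i w)).
  by apply: measurable_prod => i _; exact: measurable_pair_sample.
by apply/funext => w; rewrite big_filter.
Qed.

Let WS (i : 'I_m) w : W i.+1 w = phi (x i w, x' i w) * W i w.
Proof.
rewrite /W (bigD1 i)//=; congr (_ * _); apply: eq_bigl => j.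
by rewrite ltnS ltn_neqAle andbC.
Qed.

(** Update of the running product once both points of a new pair are adjoined. *)
Let step (v : T * (T * R)) : R := phi (v.1, v.2.1) * v.2.2.

Let mstep : measurable_fun setT step.
Proof.
apply: measurable_funM; last exact: measurableT_comp.
apply: (@measurableT_comp _ _ _ _ _ _ phi) => //.
apply: measurable_fun_pair; first exact: measurable_fst.
exact: (measurableT_comp measurable_fst measurable_snd).
Qed.

HB.instance Definition _ := isMeasurableFun.Build _ _ _ _ step mstep.

(** The law of the running product lives on the whole real line; integrating the
absolute value keeps the integrands nonnegative there. *)
Let absR_meas : measurable_fun setT (fun v : R => `|v|%:E).
Proof. by apply/measurable_EFinP; exact: measurable_realfun.normr_measurable. Qed.

Let integral_step (law : probability R R) (pair_law : probability (T * R)%type R) :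
  pair_law = (mu \x law)%E :> (set (T * R) -> \bar R) ->
  (\int[(mu \x pair_law)]_v `|step v|%:E = c%:E * \int[law]_v `|v|%:E)%E.
Proof.
move=> pairE; set a := (\int[law]_v _)%E.
have a0 : (0 <= a)%E by apply: integral_ge0.
have mS : measurable_fun setT (fun v => `|step v|%:E : \bar R).
  exact: (measurableT_comp absR_meas mstep).
have mphiE : measurable_fun setT (EFin \o phi) by exact/measurable_EFinP.
rewrite fubini_tonelli1//= /fubini_F.
transitivity (\int[mu]_t (a * \int[mu]_t' (phi (t, t'))%:E))%E.
  apply: eq_integral => t _.
  transitivity (\int[(mu \x law)]_v `|step (t, v)|%:E)%E; first by rewrite -pairE.
  have mphit : measurable_fun setT (fun t' => (phi (t, t'))%:E).
    exact: (measurableT_comp mphiE (measurable_pair1 t)).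
  rewrite fubini_tonelli1//=; last first.
    exact: (measurableT_comp mS (measurable_pair1 t)).
  rewrite -ge0_integralZl//; last by move=> t' _; rewrite lee_fin.
  apply: eq_integral => t' _; rewrite /fubini_F/= muleC.
  rewrite -ge0_integralZl ?lee_fin//.
  by apply: eq_integral => v _; rewrite /step/= normrM ger0_norm.
rewrite ge0_integralZl//.
- by rewrite muleC -phic [in RHS]fubini_tonelli1// => z; rewrite lee_fin.
- have := @measurable_fun_fubini_tonelli_F _ _ T T R mu _ mphiE.
  by apply=> z; rewrite /= lee_fin.
- by move=> t _; apply: integral_ge0 => t' _; rewrite lee_fin.
Qed.

(** Induction on the number of pairs absorbed; the running product before the first
pair is the constant 1, with a Dirac law. *)
Let law_W k : (k <= m)%N -> exists law : probability R R,
  indep_remaining P mu (pooled x x') (W k) law (remaining k) /\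
  (\int[law]_v `|v|%:E = (c ^+ k)%:E)%E.
Proof.
elim: k => [_|k IH km].
  exists (@dirac _ R (1 : R) R : probability _ _); split; last first.
    by rewrite integral_dirac//= diracT mul1e normr1 expr0.
  have [_ law indep] := sample.
  move=> B A mB mA; have W1 w : W 0 w = 1 by rewrite /W big_pred0.
  rewrite /= diracE; have [B1|B1] := boolP (1 \in B).
    rewrite mul1e -(eq_bigr _ (fun i _ => law i _ (mA i))) -indep//.
    congr (P _); apply/seteqP; split => [w []//|w Hw]; split=> //=.
    by rewrite W1; exact/set_mem.
  rewrite mul0e [X in P X](_ : _ = set0) ?measure0//.
  by apply/seteqP; split => // w [/=]; rewrite W1 => /mem_set; rewrite (negbTE B1).
have [law [indep law_abs]] := IH (ltnW km).
pose i := Ordinal km.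
have mx'W : measurable_fun setT (fun w => (pooled x x' (inr i) w, W k w)).
  exact: measurable_fun_pair.
have /(indep_remaining_pair mY (mW k)) /(_ indep) : inr i \in remaining k.
  by rewrite finset.in_set /=.
move=> /(indep_remaining_pair (i := inl i) mY mx'W).
rewrite finset.in_setD1 finset.in_set leqnn => /(_ isT) indep2.
pose pair_law : probability (T * R)%type R := (mu \x law)%E.
pose triple_law : probability (T * (T * R))%type R := (mu \x pair_law)%E.
exists (distribution triple_law step : probability _ _).
split; last first.
  rewrite ge0_integral_pushforward//= (integral_step (law := law))// law_abs.
  by rewrite -EFinM exprS.
have := indep_remaining_map step indep2.
rewrite (_ : step \o _ = W k.+1); last by apply/funext => w; rewrite (WS i).
congr (indep_remaining _ _ _ _ _ _).
apply/finset.setP => -[] j; rewrite !finset.in_setD1 !finset.in_set /=.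
  by rewrite ltn_neqAle eq_sym.
by rewrite ltn_neqAle eq_sym.
Qed.

Lemma expectation_prod_iid_pairs :
  (\int[P]_w (\prod_(i < m) phi (x i w, x' i w))%:E)%E = (c ^+ m)%:E.
Proof.
have [law [indep <-]] := law_W (leqnn m).
rewrite -(indep_remaining_law (mW m) indep absR_meas) => [|v]; last first.
  by rewrite lee_fin.
apply: eq_integral => w _; have -> : W m w = \prod_(i < m) phi (x i w, x' i w).
  by apply: eq_bigl => i; rewrite ltn_ord.
by rewrite ger0_norm//; apply: prodr_ge0 => i _.
Qed.

End iid_pairs.

(** * Hoeffding's inequality *)

Section hoeffding.
Context (R : realType) (d d' : measure_display) (Omega : measurableType d)
  (T : measurableType d') (P : probability Omega R) (mu : probability T R)
  (m : nat) (x x' : 'I_m -> Omega -> T).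
Hypothesis sample : iid_sample P mu (pooled x x').
Hypothesis m_gt0 : (0 < m)%N.

Lemma measurable_empirical_mean (h : T * T -> R) : measurable_fun setT h ->
  measurable_fun setT (fun w => 1 / m%:R * \sum_(i < m) h (x i w, x' i w)).
Proof.
move=> mh; apply: measurable_funM; first exact: measurable_cst.
by apply: measurable_sum => i; exact: (measurable_pair_sample sample).
Qed.

(** Chernoff's method: the exponent s t - s^2 b^2 / 8 is maximal at s = 4 t / b^2,
where it equals 2 t^2 / b^2. *)
Lemma hoeffding_upper (h : T * T -> R) (b t : R) : measurable_fun setT h ->
  (forall z, 0 <= h z <= b) -> 0 < b -> 0 < t ->
  (P [set w | (\int[(mu \x mu)%E]_z h z + t <=
      1 / m%:R * \sum_(i < m) h (x i w, x' i w))%R] <=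
    (expR (- (2 * m%:R * t ^+ 2 / b ^+ 2)))%:E)%E.
Proof.
move=> mh hb b0 t0.
pose nu : probability (T * T)%type R := (mu \x mu)%E.
rewrite -[X in (X + t)%R]/(\int[nu]_z h z).
set mean := \int[nu]_z h z; set A := [set w | _].
have mA : measurable A.
  rewrite -[A]setTI; apply: measurable_fun_le => //.
  exact: measurable_empirical_mean.
have bneq0 : b != 0 by rewrite gt_eqF.
have mR : 0 < m%:R :> R by rewrite ltr0n.
have mRneq0 : m%:R != 0 :> R by rewrite gt_eqF.
pose s := 4 * t / b ^+ 2.
have s0 : 0 <= s by rewrite divr_ge0 ?sqr_ge0// mulr_ge0// ltW.
pose phi z := expR (s * h z).
have mphi : measurable_fun setT phi.
  by apply: measurableT_comp => //; exact: measurable_funM.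
have phi0 z : 0 <= phi z by exact: expR_ge0.
have phi_int : nu.-integrable setT (EFin \o phi).
  apply: (@bounded_integrable _ _ _ _ _ (expR (s * b))) => // z.
  rewrite ger0_norm// ler_expR ler_wpM2l//.
  by have /andP[] := hb z.
pose c := \int[nu]_z phi z.
have phic : (\int[mu \x mu]_z (phi z)%:E = c%:E)%E.
  by rewrite /c /Rintegral fineK//; exact: integrable_fin_num.
have := mgf_bounded_le nu mh hb b0 s0; rewrite -/phi -/c -/mean => c_le.
have c0 : 0 <= c by apply: Rintegral_ge0.
pose Q w := \prod_(i < m) phi (x i w, x' i w).
have Q0 w : 0 <= Q w by apply: prodr_ge0.
have mQ : measurable_fun setT (EFin \o Q).
  apply/measurable_EFinP; apply: measurable_prod => i _.
  exact: (measurable_pair_sample sample).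
have EQ := expectation_prod_iid_pairs sample mphi phi0 phic.
pose K := expR (s * (m%:R * (mean + t))).
have AQ w : A w -> K <= Q w.
  rewrite /A/= /Q /phi -expR_sum -mulr_sumr => Aw.
  rewrite ler_expR ler_wpM2l// mulrC -ler_pdivlMr// mulrC -[X in X * _]div1r//.
have KP : (K%:E * P A <= (c ^+ m)%:E)%E.
  rewrite -EQ -integral_cst//.
  apply: (@le_trans _ _ (\int[P]_(w in A) (Q w)%:E)%E).
    apply: ge0_le_integral => //.
    - by move=> w _; rewrite lee_fin expR_ge0.
    - exact: measurable_funTS.
  apply: ge0_subset_integral => //.
  by move=> w _; rewrite lee_fin.
have K0 : 0 < K by exact: expR_gt0.
have : (P A <= (c ^+ m / K)%:E)%E.
  by rewrite EFinM muleC lee_pdivlMl.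
move=> /le_trans; apply; rewrite lee_fin ler_pdivrMr//.
apply: (@le_trans _ _ (expR (s * mean + (s * b) ^+ 2 / 8) ^+ m)).
  by apply: lerXn2r => //; rewrite nnegrE ?expR_ge0.
rewrite -expRM_natl -expRD ler_expR le_eqVlt; apply/orP; left; apply/eqP.
by rewrite /s; field.
Qed.

(** The reflection h -> b - h exchanges the two tails. *)
Lemma hoeffding_lower (h : T * T -> R) (b t : R) : measurable_fun setT h ->
  (forall z, 0 <= h z <= b) -> 0 < b -> 0 < t ->
  (P [set w | (1 / m%:R * \sum_(i < m) h (x i w, x' i w) <=
      \int[(mu \x mu)%E]_z h z - t)%R] <=
    (expR (- (2 * m%:R * t ^+ 2 / b ^+ 2)))%:E)%E.
Proof.
move=> mh hb b0 t0.
pose nu : probability (T * T)%type R := (mu \x mu)%E.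
pose h' z := b - h z.
have mh' : measurable_fun setT h' by apply: measurable_funB.
have hb' z : 0 <= h' z <= b.
  by rewrite /h' subr_ge0 gerBl andbC; exact: hb.
have := hoeffding_upper mh' hb' b0 t0.
rewrite -[X in (X + t)%R]/(\int[nu]_z h' z)
  -[X in (_ -> (P [set w | (_ <= X - t)%R] <= _)%E)]/(\int[nu]_z h z).
have -> : \int[nu]_z h' z = b - \int[nu]_z h z.
  rewrite RintegralB//.
  - by rewrite Rintegral_cst//= probability_setT mulr1.
  - by apply: (@bounded_integrable _ _ _ _ _ b) => // z; rewrite ger0_norm// ltW.
  - apply: (@bounded_integrable _ _ _ _ _ b) => // z.
    by have /andP[? ?] := hb z; rewrite ger0_norm.
rewrite [X in (P X <= _)%E -> _](_ : _ = [set w | (1 / m%:R * \sum_(i < m) h (x i w, x' i w) <=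
      \int[nu]_z h z - t)%R]) //.
apply/funext => w; apply/propext => /=.
have -> : 1 / m%:R * \sum_(i < m) h' (x i w, x' i w) =
    b - 1 / m%:R * \sum_(i < m) h (x i w, x' i w).
  rewrite sumrB sumr_const card_ord mulrBr -[b *+ m]mulr_natl.
  by rewrite mulrA div1r mulVf ?mul1r// pnatr_eq0 -lt0n.
by split => ?; lra.
Qed.

End hoeffding.

(** * Measurability and the union bound *)

Section measurability.
Context (R : realType).

(** Coordinates are continuous, hence Borel; real-valued expressions in the
coordinates are then handled by the usual closure properties. *)
Lemma borel_measurable_coord (d : measure_display) (T : measurableType d)
    (n : nat) (f : T -> 'rV[R]_n) (j : 'I_n) :
  borel_measurable f -> measurable_fun setT (fun x => f x 0 j).
Proof.
move=> mf.
have mcoord : measurable_fun setT (fun v : borel_rV R n => (v : 'rV[R]_n) 0 j).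
  apply: (measurability _ (RGenOInfty.measurableE R)) => _ [_ [a ->] <-].
  rewrite setTI; apply: sub_sigma_algebra; apply: open_comp.
    by move=> v _; exact: coord_continuous.
  exact: interval_open.
exact: measurableT_comp mcoord mf.
Qed.

Lemma measurable_norm2_sqr (d : measure_display) (T : measurableType d)
    (n : nat) (f : T -> 'rV[R]_n) : borel_measurable f ->
  measurable_fun setT (fun z : T * T => norm2 (f z.1 - f z.2) ^+ 2).
Proof.
move=> mf; under eq_fun do rewrite norm2_sqr.
apply: measurable_sum => j; apply: measurable_funX.
under eq_fun do rewrite !mxE.
have mfj := borel_measurable_coord j mf.
apply: measurable_funB; first exact: (measurableT_comp mfj measurable_fst).
exact: (measurableT_comp mfj measurable_snd).
Qed.

Lemma weightE (M : finType) (T : Type) (dim : M -> nat)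
    (m_ : forall j, T -> 'rV[R]_(dim j)) (gamma : R) (x x' : T) (S : {set M}) :
  weight m_ gamma x x' S =
  Num.min (\sum_(j in S) 1 / gamma ^+ 2 * norm2 (m_ j x - m_ j x') ^+ 2) 1.
Proof. by rewrite /weight norm2_sqr_concat mulr_sumr. Qed.

Lemma measurable_integrand (d : measure_display) (T : measurableType d)
    (M : finType) (q : nat) (dim : M -> nat)
    (g : T -> 'rV[R]_q) (m_ : forall j : M, T -> 'rV[R]_(dim j))
    (gamma : R) (S : {set M}) : borel_measurable g ->
  (forall j, borel_measurable (m_ j)) ->
  measurable_fun setT (fun z : T * T => integrand g m_ gamma z.1 z.2 S).
Proof.
move=> mg mm; apply: measurable_funM; last exact: measurable_norm2_sqr.
under eq_fun do rewrite weightE -big_enum.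
apply: measurable_minr => //; apply: measurable_sum => j.
by apply: measurable_funM => //; exact: measurable_norm2_sqr.
Qed.

(** A condition that depends only on the order of finitely many random variables
cuts out a finite union of intersections of comparison events. *)
Lemma measurable_comparison_event (d : measure_display) (Omega : measurableType d)
    (I : finType) (F : I -> Omega -> R) (Q : (I -> R) -> Prop) :
  (forall i, measurable_fun setT (F i)) ->
  (forall f f' : I -> R, (forall i j, (f i <= f j) = (f' i <= f' j)) ->
    Q f -> Q f') ->
  measurable [set w | Q (F ^~ w)].
Proof.
move=> mF Qext.
pose cmp w : {ffun I * I -> bool} := [ffun ij => F ij.1 w <= F ij.2 w].
have mcmp r : measurable [set w | cmp w = r].
  rewrite (_ : [set w | _] =
      \bigcap_(ij in [set: I * I]) [set w | (F ij.1 w <= F ij.2 w) = r ij]).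
    apply: fin_bigcap_measurable => // ij _; rewrite -[X in measurable X]setTI.
    have mle := measurable_fun_ler (mF ij.1) (mF ij.2).
    exact: (mle measurableT [set r ij]).
  apply/seteqP; split => w /=; first by move=> <- ij _; rewrite ffunE.
  by move=> H; apply/ffunP => ij; rewrite ffunE; exact: H.
rewrite (_ : [set w | _] =
    \bigcup_(r in [set r | exists2 w, cmp w = r & Q (F ^~ w)]) [set w | cmp w = r]).
  by apply: fin_bigcup_measurable => // r _.
apply/seteqP; split => w /=; first by move=> Qw; exists (cmp w) => //; exists w.
move=> [r [v vr Qv] wr]; apply: Qext Qv => i j.
by have := congr1 (fun r : {ffun I * I -> bool} => r (i, j)) (etrans vr (esym wr)); rewrite !ffunE.
Qed.

Lemma union_bound (d : measure_display) (Omega : measurableType d)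
    (P : probability Omega R) (I : Type) (s : seq I) (B : I -> set Omega) (c : R) :
  (forall i, measurable (B i)) -> (forall i, (P (B i) <= c%:E)%E) ->
  (P (\big[setU/set0]_(i <- s) B i) <= ((size s)%:R * c)%:E)%E.
Proof.
move=> mB Bc; elim: s => [|i s IH]; first by rewrite big_nil measure0 mul0r.
rewrite big_cons/= -natr1 mulrDl mul1r addrC EFinD.
apply: le_trans (leeD (Bc i) IH); apply: measureU2 => //.
exact: bigsetU_measurable.
Qed.

End measurability.

(** * The sampled objective and the sample size *)

Section sampled_objective_greedy.
Context (R : realType) (M : finType) (T : Type) (q : nat) (dim : M -> nat)
  (g : T -> 'rV[R]_q) (m_ : forall j : M, T -> 'rV[R]_(dim j))
  (gamma : R).

Lemma scaled_gap_ge0 j x x' :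
  0 <= 1 / gamma ^+ 2 * norm2 (m_ j x - m_ j x') ^+ 2.
Proof. by rewrite mulr_ge0 ?sqr_ge0// divr_ge0 ?sqr_ge0. Qed.

Lemma weight_bounds x x' (S : {set M}) : 0 <= weight m_ gamma x x' S <= 1.
Proof.
rewrite weightE le_min ge_min lexx orbT ler01 !andbT.
by apply: sumr_ge0 => j _; exact: scaled_gap_ge0.
Qed.

Lemma integrand_bounds (D : R) x x' (S : {set M}) :
  (forall y y', norm2 (g y - g y') <= D) ->
  0 <= integrand g m_ gamma x x' S <= D ^+ 2.
Proof.
move=> gD; have /andP[w0 w1] := weight_bounds x x' S.
have n0 : 0 <= norm2 (g x - g x') by exact: sqrtr_ge0.
rewrite /integrand mulr_ge0 ?sqr_ge0//=.
apply: (@le_trans _ _ (1 * norm2 (g x - g x') ^+ 2)).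
  by rewrite ler_wpM2r ?sqr_ge0.
by rewrite mul1r lerXn2r ?nnegrE// (le_trans n0).
Qed.

Lemma integrand_set0 x x' : integrand g m_ gamma x x' finset.set0 = 0.
Proof. by rewrite /integrand weightE big_set0 (min_idPl ler01) mul0r. Qed.

Context (m : nat) (x x' : 'I_m -> T).
Let F := sampled_objective g m_ gamma x x'.

Let c i := 1 / m%:R * norm2 (g (x i) - g (x' i)) ^+ 2.

(** Each weight is a truncated sum, so the properties of truncated sums transfer
term by term. *)
Let FE S : F S = \sum_i c i * weight m_ gamma (x i) (x' i) S.
Proof.
rewrite /F /sampled_objective mulr_sumr; apply: eq_bigr => i _.
by rewrite /c /integrand mulrCA mulrC.
Qed.

Let c0 i : 0 <= c i.
Proof. by rewrite mulr_ge0 ?sqr_ge0// divr_ge0. Qed.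

Lemma sampled_objective_set0 : F finset.set0 = 0.
Proof.
by rewrite /F /sampled_objective big1 ?mulr0// => i _; exact: integrand_set0.
Qed.

Lemma sampled_objective_monotone : monotone_set F.
Proof.
move=> S S' SS'; rewrite !FE; apply: ler_sum => i _; apply: ler_wpM2l => //.
rewrite !weightE; apply: (truncated_sum_monotone _ SS') => j.
exact: scaled_gap_ge0.
Qed.

Lemma sampled_objective_gain_bounded : gain_bounded F.
Proof.
move=> S S'.
under eq_bigr do rewrite !FE -sumrB.
rewrite !FE exchange_big/= -big_split/=; apply: ler_sum => i _.
under eq_bigr do rewrite -mulrBr.
rewrite -mulr_sumr -mulrDr ler_wpM2l//.
rewrite (funext (weightE m_ gamma (x i) (x' i))).
apply: truncated_sum_gain_bounded => j; exact: scaled_gap_ge0.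
Qed.

(** A greedy run on the sampled objective is nearly optimal for any objective f that
is uniformly within eps of it on small sets. *)
Lemma greedy_run_sampled_approx (f : {set M} -> R) (eps : R) (L K : nat)
    (Sstar : {set M}) (S : nat -> {set M}) :
  (forall U : {set M}, (#|U| <= L)%N -> `|F U - f U| <= eps) ->
  (0 < K)%N -> (K <= L)%N -> (#|Sstar| <= K)%N -> greedy_run F L S ->
  forall k, (k <= L)%N ->
  (1 - expR (- (k%:R / K%:R))) * f Sstar - (2 - expR (- (k%:R / K%:R))) * eps
    <= f (S k).
Proof.
move=> close K0 KL SK run k kL; set a := expR _.
have a1 : a <= 1 by rewrite -[leRHS]expR0 ler_expR oppr_le0 divr_ge0.
have := greedy_run_approx sampled_objective_set0 sampled_objective_monotone
  sampled_objective_gain_bounded run K0 SK kL.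
rewrite -/a => greedy.
have := close (S k); rewrite (greedy_run_card run kL) => /(_ kL).
rewrite ler_distl => /andP[_ Fk].
have := close Sstar (leq_trans SK KL); rewrite ler_distl => /andP[FS _].
have a0 : 0 <= 1 - a by rewrite subr_ge0.
have := ler_wpM2l a0 FS.
rewrite mulrBr; lra.
Qed.

End sampled_objective_greedy.

Lemma greedy_run_comparison (R : realType) (M : finType) (f f' : {set M} -> R)
    (L : nat) (S : nat -> {set M}) :
  (forall A B, (f A <= f B) = (f' A <= f' B)) ->
  greedy_run f L S -> greedy_run f' L S.
Proof.
move=> ff' [S0 step]; split=> // k kL; have [j jS [Sk best]] := step k kL.
by exists j => //; split=> // j' j'S; rewrite -ff'; exact: best.
Qed.

(** The bracket X in the sample size is chosen so that exp(-X) is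
(L-1)! / n^L * p / 2: two tails for each of N <= n^L / (L-1)! events add up to
at most p. *)
Lemma sample_size_bound (R : realType) (n N L m : nat) (D eps p : R) :
  0 < D -> 0 < eps -> 0 < p -> (0 < L)%N -> (L <= n)%N ->
  (N * (L - 1)`! <= n ^ L)%N ->
  D ^+ 4 / (2 * eps ^+ 2) * (L%:R * ln n%:R - ln ((L - 1)`!)%:R - ln (p / 2))
    <= m%:R ->
  N%:R * (2 * expR (- (2 * m%:R * eps ^+ 2 / (D ^+ 2) ^+ 2))) <= p.
Proof.
move=> D0 e0 p0 L0 Ln NL mge.
have n0 : 0 < n%:R :> R by rewrite ltr0n (leq_trans L0).
have f0 : 0 < ((L - 1)`!)%:R :> R by rewrite ltr0n fact_gt0.
have nL0 : 0 < n%:R ^+ L :> R by rewrite exprn_gt0.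
have p20 : 0 < p / 2 by rewrite divr_gt0.
set X := _ - ln (p / 2) in mge.
have Xle : X <= 2 * m%:R * eps ^+ 2 / (D ^+ 2) ^+ 2.
  rewrite ler_pdivlMr ?exprn_gt0// -(@ler_pM2l _ (2 * eps ^+ 2)^-1); last first.
    by rewrite invr_gt0 mulr_gt0// exprn_gt0.
  have -> : (2 * eps ^+ 2)^-1 * (2 * m%:R * eps ^+ 2) = m%:R.
    by field; rewrite gt_eqF.
  by apply: le_trans mge; rewrite le_eqVlt; apply/orP; left; apply/eqP; field; rewrite gt_eqF.
have eX : expR (- X) = ((L - 1)`!)%:R / n%:R ^+ L * (p / 2).
  have -> : - X = ln ((L - 1)`!)%:R + ln (p / 2) - ln (n%:R ^+ L).
    by rewrite /X lnXn// -mulr_natl; ring.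
  by rewrite !expRD expRN !lnK ?posrE// mulrAC.
apply: (@le_trans _ _ (N%:R * (2 * expR (- X)))).
  by rewrite ler_wpM2l// ler_wpM2l// ler_expR lerN2.
rewrite eX [leLHS](_ : _ = (N * (L - 1)`!)%:R / n%:R ^+ L * p); last first.
  by rewrite natrM; field; rewrite gt_eqF.
apply: ler_piMl; first exact: ltW.
by rewrite ler_pdivrMr// mul1r -natrX ler_nat.
Qed.

(** Since (L-1)! <= n^L and p / 2 < 1, the required sample size is positive; an
empty sample would make the empirical mean meaningless. *)
Lemma sample_size_gt0 (R : realType) (n L m : nat) (D eps p : R) :
  0 < D -> 0 < eps -> 0 < p -> p < 1 -> (0 < L)%N -> (L <= n)%N ->
  D ^+ 4 / (2 * eps ^+ 2) * (L%:R * ln n%:R - ln ((L - 1)`!)%:R - ln (p / 2))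
    <= m%:R ->
  (0 < m)%N.
Proof.
move=> D0 e0 p0 p1 L0 Ln; rewrite lt0n; apply: contraTneq => ->.
have n0 : 0 < n%:R :> R by rewrite ltr0n (leq_trans L0).
rewrite -ltNge mulr_gt0 ?divr_gt0 ?mulr_gt0 ?exprn_gt0//.
have : ln (p / 2) < 0 by apply: ln_lt0; lra.
suff : ln ((L - 1)`!)%:R <= L%:R * ln n%:R :> R by lra.
have n0' : (0 < n)%N by rewrite (leq_trans L0).
rewrite mulr_natl -lnXn// ler_ln ?posrE ?exprn_gt0 ?ltr0n ?fact_gt0//.
rewrite -natrX ler_nat.
have := expn_fact_le (leq0n L) Ln; rewrite expn0 mul1n muln1.
by apply: leq_trans; apply: leq_fact; exact: leq_subr.
Qed.

(** The two Hoeffding tails of every function in a finite family, collected by the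
union bound into one exceptional measurable event. *)
Lemma uniform_deviation (R : realType) (d d' : measure_display)
    (Omega : measurableType d) (T : measurableType d')
    (P : probability Omega R) (mu : probability T R) (I : finType)
    (A : {set I}) (h : I -> T * T -> R) (b eps p : R)
    (m : nat) (x x' : 'I_m -> Omega -> T) :
  iid_sample P mu (pooled x x') ->
  (forall i, measurable_fun setT (h i)) ->
  (forall i z, 0 <= h i z <= b) -> 0 < b -> 0 < eps -> (0 < m)%N ->
  #|A|%:R * (2 * expR (- (2 * m%:R * eps ^+ 2 / b ^+ 2))) <= p ->
  exists2 B : set Omega, measurable B /\ (P B <= p%:E)%E &
    forall w, ~ B w -> forall i, i \in A ->
      `|1 / m%:R * (\sum_(j < m) h i (x j w, x' j w)) -
        \int[(mu \x mu)%E]_z h i z| <= eps.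
Proof.
move=> sample mh hb b0 e0 m0 small.
pose emp i w := 1 / m%:R * \sum_(j < m) h i (x j w, x' j w).
pose mean i := \int[(mu \x mu)%E]_z h i z.
pose up i := [set w | mean i + eps <= emp i w].
pose low i := [set w | emp i w <= mean i - eps].
have memp i : measurable_fun setT (emp i) by exact: (measurable_empirical_mean sample (mh i)).
have mup i : measurable (up i).
  by rewrite -[up i]setTI; apply: measurable_fun_le.
have mlow i : measurable (low i).
  by rewrite -[low i]setTI; apply: measurable_fun_le.
have mUL i : measurable (up i `|` low i) by exact: measurableU.
exists (\big[setU/set0]_(i <- enum A) (up i `|` low i)).
  split; first exact: bigsetU_measurable.
  apply: (@le_trans _ _ (#|A|%:R *
    (2 * expR (- (2 * m%:R * eps ^+ 2 / b ^+ 2))))%:E)%E; last by rewrite lee_fin.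
  rewrite cardE; apply: union_bound => // i.
  rewrite mulr_natl mulr2n EFinD; apply: le_trans (measureU2 P (mup i) (mlow i)) _.
  apply: leeD; first exact: hoeffding_upper.
  exact: hoeffding_lower.
move=> w wB i iA; rewrite -/(emp i w) -/(mean i) ler_distl.
have {}wB : ~ (up i `|` low i) w.
  move=> Hw; apply: wB; rewrite -bigcup_seq; exists i => //=.
  by rewrite mem_enum.
apply/andP; split; rewrite leNgt; apply/negP => Hw; apply: wB.
  by right; exact: ltW.
by left; exact: ltW.
Qed.

(** * The approximation guarantee *)

Theorem theorem5p2 (R : realType) (n : nat) (X : set 'rV[R]_n) (X0 : X !=set0)
  (mu : probability (domain X0) R)
  (M : finType) (q : nat) (dim : M -> nat)
  (g : domain X0 -> 'rV[R]_q) (m_ : forall j : M, domain X0 -> 'rV[R]_(dim j))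
  (g_meas : borel_measurable g)
  (m_meas : forall j : M, borel_measurable (m_ j))
  (gamma eps p : R) (gamma_gt0 : 0 < gamma) (eps_gt0 : 0 < eps)
  (p_gt0 : 0 < p) (p_lt1 : p < 1)
  (L : nat) (L_ge1 : (1 <= L)%N) (L_le : (L <= #|M|)%N)
  (D : R)
  (D_sup : ereal_sup [set (norm2 (g z.1 - g z.2))%:E
                     | z in [set: domain X0 * domain X0]] = D%:E)
  (m : nat)
  (m_ge : D ^+ 4 / (2 * eps ^+ 2)
            * (L%:R * ln (#|M|%:R) - ln (((L - 1)`!)%:R) - ln (p / 2))
          <= m%:R)
  (d : measure_display) (Omega : measurableType d) (P : probability Omega R)
  (x x' : 'I_m -> Omega -> domain X0)
  (sample : iid_sample P mu (pooled x x'))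
  (K : nat) (K_ge1 : (1 <= K)%N) (K_le : (K <= L)%N)
  (Sstar : {set M}) (Sstar_card : (#|Sstar| <= K)%N)
  (Sstar_max : forall S : {set M}, (#|S| <= K)%N ->
     objective mu g m_ gamma S <= objective mu g m_ gamma Sstar) :
  ((1 - p)%:E <=
   P [set omega | forall S : nat -> {set M},
        greedy_run
          (sampled_objective g m_ gamma (fun i => x i omega)
                                        (fun i => x' i omega)) L S ->
        forall k : nat, (1 <= k <= L)%N ->
          (objective mu g m_ gamma (S k) >=
            (1 - expR (- (k%:R / K%:R))) * objective mu g m_ gamma Sstar
            - (2 - expR (- (k%:R / K%:R))) * eps)%R])%E.
Proof.
have gD y y' : norm2 (g y - g y') <= D.
  by rewrite -lee_fin -D_sup; apply: ereal_sup_ubound; exists (y, y').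
have D0 : 0 <= D.
  apply: le_trans (gD (domain_point X0) (domain_point X0)).
  exact: sqrtr_ge0.
pose h (U : {set M}) (z : domain X0 * domain X0) := integrand g m_ gamma z.1 z.2 U.
have mh U : measurable_fun setT (h U) by exact: measurable_integrand.
pose F w := sampled_objective g m_ gamma (fun i => x i w) (fun i => x' i w).
have [B [mB PB] close] : exists2 B : set Omega, measurable B /\ (P B <= p%:E)%E &
    forall w, ~ B w -> forall U : {set M}, (#|U| <= L)%N ->
      `|F w U - objective mu g m_ gamma U| <= eps.
  have zero U : (forall z, h U z = 0) -> objective mu g m_ gamma U = 0.
    move=> hU; rewrite /objective /Rintegral integral0_eq// => z _.
    by rewrite [integrand _ _ _ _ _ _]hU.
  have Fzero w U : (forall z, h U z = 0) -> F w U = 0.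
    move=> hU; rewrite /F /sampled_objective big1 ?mulr0// => i _.
    exact: (hU (x i w, x' i w)).
  (* Hoeffding's inequality needs a positive range, so D = 0 is separate. *)
  have [D_eq0|D_neq0] := eqVneq D 0.
    have hU U z : h U z = 0.
      apply/eqP; rewrite eq_le andbC.
      by have := integrand_bounds m_ gamma z.1 z.2 U gD; rewrite D_eq0 expr0n.
    exists set0; first by rewrite measure0 lee_fin ltW.
    by move=> w _ U _; rewrite zero// Fzero// subrr normr0 ltW.
  have {D_neq0}D_gt0 : 0 < D by rewrite lt_neqAle eq_sym D_neq0.
  have m_gt0 := sample_size_gt0 D_gt0 eps_gt0 p_gt0 p_lt1 L_ge1 L_le m_ge.
  have small := sample_size_bound D_gt0 eps_gt0 p_gt0 L_ge1 L_le
    (card_small_sets L_ge1 L_le) m_ge.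
  have [B [mB PB] close] := uniform_deviation sample mh
    (fun U z => integrand_bounds m_ gamma z.1 z.2 U gD) (exprn_gt0 2 D_gt0)
    eps_gt0 m_gt0 small.
  exists B => // w wB U UL.
  (* The empty set is left out of the union bound: both objectives vanish there. *)
  have [U0|U0] := posnP #|U|.
    have hU z : h U z = 0 by rewrite (cards0_eq U0); exact: integrand_set0.
    by rewrite zero// Fzero// subrr normr0 ltW.
  by apply: (close w wB U); rewrite finset.in_set U0.
set E := [set omega | _].
have mE : measurable E.
  apply: (@measurable_comparison_event _ _ _ _ (fun U w => F w U)
    (fun f => forall S, greedy_run f L S -> forall k, (1 <= k <= L)%N ->
      (1 - expR (- (k%:R / K%:R))) * objective mu g m_ gamma Sstar
        - (2 - expR (- (k%:R / K%:R))) * eps <= objective mu g m_ gamma (S k))).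
    by move=> U; exact: (measurable_empirical_mean sample (mh U)).
  move=> f f' ff' Qf S run; apply: Qf.
  by apply: greedy_run_comparison run => U V; rewrite ff'.
have BE : ~` B `<=` E.
  move=> w wB S run k /andP[_ kL].
  exact: (greedy_run_sampled_approx (close w wB) K_ge1 K_le Sstar_card run kL).
apply: (@le_trans _ _ (P (~` B))).
  by rewrite probability_setC// EFinB leeB.
by apply: le_measure; rewrite ?inE//; exact: measurableC.
Qed.
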